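(* A compact Hausdorff space $X$ is S-separable if and only if $\pi w(X)=\omega$ (that is, if and only if $X$ has a countable $\pi$-base).
   Context: A space $X$ is S-separable if for every sequence $(Y_n)_{n\in\mathbb{N}}$ of dense subspaces of $X$ there exists a sequence $(F_n)_{n\in\mathbb{N}}$ such that each $F_n$ is a finite subset of $Y_n$ and for each finite collection $\mathcal{F}$ of nonempty open sets of $X$ there exists $n\in\mathbb{N}$ with $U\cap F_n\neq\emptyset$ for all $U\in\mathcal{F}$. A $\pi$-base of $X$ is a collection $\mathcal{B}$ of open sets such that every nonempty open set of $X$ contains a nonempty member of $\mathcal{B}$; $\pi w(X)$ is the minimal cardinality of a $\pi$-base, with the usual convention that cardinal functions take infinite values, so $\pi w(X)=\omega$ means that $X$ has a countable (possibly finite) $\pi$-base. *)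

(* Defs.v *)
From mathcomp Require Import all_boot all_order.
From mathcomp Require Import all_classical.
From mathcomp Require Import topology.

Set Implicit Arguments.
Unset Strict Implicit.
Unset Printing Implicit Defensive.

Local Open Scope classical_set_scope.

Definition S_separable (X : topologicalType) : Prop :=
  forall Y : nat -> set X, (forall n, dense (Y n)) ->
  exists F : nat -> set X,
    (forall n, finite_set (F n) /\ F n `<=` Y n) /\
    forall G : set (set X), finite_set G ->
      (forall U, G U -> open U /\ U !=set0) ->
      exists n, forall U, G U -> U `&` F n !=set0.

Definition pi_base (X : topologicalType) (B : set (set X)) : Prop :=
  (forall V, B V -> open V) /\
  forall U : set X, open U -> U !=set0 ->
    exists V, [/\ B V, V !=set0 & V `<=` U].

(* pi-weight equal to omega: since cardinal functions take infinite values,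
   this says that the least cardinality of a pi-base is at most omega.
   [countable] includes the finite case. *)
Definition pi_weight_omega (X : topologicalType) : Prop :=
  exists B : set (set X), countable B /\ pi_base B.

(* Main.v *)
(** Say that W refines O when W is contained in the closure of O; by regularity
    it suffices to refine all nonempty open sets by countably many.

    S-separability is only used through one consequence: every dense set
    contains a countable dense set. Given open sets O_a indexed by a
    well-order, each nonempty open u greedily accepts the indices a such that
    u minus the closures of finitely many accepted O_b, b < a, is never
    contained in the closure of O_a. By compactness some y_u in the closure of
    u avoids every accepted O_a. The y_u form a dense set; take countably many
    u_n with {y_(u_n)} dense. Every O_a then contains some y_(u_n), so a is
    rejected by u_n: O_a is refined by a nonempty set W = u_n minus the
    closures of finitely many O_b with b < a.

    If b is the largest index in that finite set, the sets W obtained with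
    this b form a family indexed by (finite subsets of {c | c <= b}) x nat,
    which may be assumed countably refined by transfinite induction on initial
    segments. These refinements, indexed by b, are a new family to which the
    greedy step applies again. Following a given O_a through the rounds, the
    index strictly decreases, so after finitely many rounds no b is left and
    O_a is refined by one of the countably many u_n used in all rounds. *)

Require Import Defs.
From mathcomp Require Import all_boot all_order.
From mathcomp Require Import all_classical wochoice.
From mathcomp Require Import topology.

Set Implicit Arguments.
Unset Strict Implicit.
Unset Printing Implicit Defensive.

Local Open Scope classical_set_scope.

(** * Strict well-orders *)

Lemma well_order_lt (T : eqType) : exists lt : T -> T -> Prop,
  [/\ well_founded lt, (forall a b c, lt a b -> lt b c -> lt a c)
    & forall a b, [\/ lt a b, a = b | lt b a]].
Proof.
have [R woR] := well_ordering_principle T.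
have minP (P : T -> Prop) a : P a -> exists2 z, P z & forall b, P b -> R z b.
  move=> Pa; have [|z [[/asboolP Pz zP] _]] := woR (fun x => `[< P x >]).
    by exists a; apply/asboolP.
  by exists z => // b Pb; apply: zP; apply/asboolP.
have Rxx a : R a a.
  by have [z -> /(_ a erefl)] := minP (eq^~ a) a erefl.
have Rtot a b : R a b \/ R b a.
  have [z [-> | ->] zP] := minP (fun x => x = a \/ x = b) a (or_introl erefl).
    by left; apply: zP; right.
  by right; apply: zP; left.
have Ranti a b : R a b -> R b a -> a = b.
  (* Both [a] and [b] are least in the pair, and the least element is unique. *)
  move=> ab ba; have [|z [_ zu]] := woR (fun x => (x == a) || (x == b)).
    by exists a; rewrite unfold_in /= eqxx.
  have minab c : c = a \/ c = b -> R c a -> R c b -> z = c.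
    move=> cab ca cb; apply: zu; split.
      by case: cab => ->; rewrite unfold_in /= eqxx ?orbT.
    by move=> x; rewrite unfold_in => /orP[]/eqP->.
  by transitivity z; [symmetry|]; apply: minab => //; [left|right].
have Rtr a b c : R a b -> R b c -> R a c.
  move=> ab bc.
  have [|z] := minP (fun x => [\/ x = a, x = b | x = c]) a; first by constructor.
  case=> -> zP.
  - by apply: zP; constructor.
  - by rewrite (Ranti a b)//; apply: zP; constructor.
  - by rewrite (Ranti b c) in ab => //; apply: zP; constructor.
exists (fun a b => R a b /\ a <> b); split.
- move=> a; apply: contrapT => nAa.
  have [z nAz zP] := minP (fun x => ~ Acc (fun a b => R a b /\ a <> b) x) _ nAa.
  apply: nAz; constructor => y [yz nyz]; apply: contrapT => /zP zy.
  by apply: nyz; apply: Ranti.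
- move=> a b c [ab nab] [bc nbc]; split; first exact: Rtr bc.
  by move=> ac; rewrite -ac in bc; apply: nab; apply: Ranti.
- move=> a b; have [->|nab] := eqVneq a b; first by constructor 2.
  by have [ab|ba] := Rtot a b; [constructor 1|constructor 3];
     split=> // e; move: nab; rewrite e eqxx.
Qed.

(** * Countable refinement of families of open sets *)

Section Refinement.
Context {X : topologicalType}.
Variable x0 : X.

Definition nopen (U : set X) : Prop := open U /\ U !=set0.

Lemma nopenT : nopen setT.
Proof. by split; [exact: openT | exists x0]. Qed.

(** Lets a family be treated as having nonempty open values at every index. *)
Definition fill (U : set X) : set X := if pselect (nopen U) then U else setT.

Lemma nopen_fill U : nopen (fill U).
Proof. by rewrite /fill; case: (pselect (nopen U)) => /= *; [by []|exact: nopenT]. Qed.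

Lemma fill_id U : nopen U -> fill U = U.
Proof. by rewrite /fill; case: (pselect (nopen U)). Qed.

(* [O] may take values that are not open or are empty; these are ignored. *)
Definition refinable (T : Type) (A : set T) : Prop :=
  forall O : T -> set X, exists2 W : nat -> set X, (forall n, nopen (W n)) &
    forall a, A a -> nopen (O a) -> exists n, W n `<=` closure (O a).

Lemma nat_reindex (C : countType) (W : C -> set X) : (forall c, nopen (W c)) ->
  exists2 V : nat -> set X, (forall n, nopen (V n)) & forall c, exists n, V n = W c.
Proof.
move=> Wo; exists (fun n => if unpickle n is Some c then W c else setT).
  by move=> n; case: unpickle => // *; exact: nopenT.
by move=> c; exists (pickle c); rewrite pickleK.
Qed.

Lemma refine_trans (U V W : set X) :
  U `<=` closure V -> V `<=` closure W -> U `<=` closure W.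
Proof.
move=> UV VW; apply: subset_trans UV _.
by rewrite ((closure_id (closure W)).1 (@closed_closure _ W)); exact: closureS.
Qed.

Lemma refinable_countable (C : countType) (A : set C) : refinable A.
Proof.
move=> O; have [V Vo VP] := nat_reindex (fun c => nopen_fill (O c)).
exists V => // a _ Oa; have [n Vn] := VP a; exists n.
by rewrite Vn fill_id//; exact: subset_closure.
Qed.

(** Refine in two stages: each row [O (a, _)] by a sequence [W a], then each column [W _ m] by a
    sequence [V m]. *)
Lemma refinable_prod (S T : Type) (A : set S) (B : set T) :
  refinable A -> refinable B -> refinable (A `*` B).
Proof.
move=> sA sB O.
have /choice[W /all_and2[Wo WP]] : forall a, exists W : nat -> set X,
    (forall n, nopen (W n)) /\
    forall b, B b -> nopen (O (a, b)) -> exists n, W n `<=` closure (O (a, b)).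
  by move=> a; have [W] := sB (fun b => O (a, b)); exists W.
have /choice[V /all_and2[Vo VP]] : forall m, exists V : nat -> set X,
    (forall n, nopen (V n)) /\
    forall a, A a -> nopen (W a m) -> exists n, V n `<=` closure (W a m).
  by move=> m; have [V] := sA (fun a => W a m); exists V.
have [Z Zo ZP] := @nat_reindex (nat * nat)%type (fun p => V p.1 p.2)
  (fun p => Vo p.1 p.2).
exists Z => // -[a b] [/= Aa Bb] Oab.
have [m Wm] := WP a b Bb Oab; have [n Vn] := VP m a Aa (Wo a m).
have [k Zk] := ZP (m, n); exists k; rewrite Zk /=.
exact: refine_trans Vn Wm.
Qed.

Lemma refinable_image (S T : Type) (f : S -> T) (A : set S) :
  refinable A -> refinable (f @` A).
Proof.
move=> sA O; have [W Wo WP] := sA (O \o f).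
by exists W => // _ [a Aa <-]; exact: WP.
Qed.

Lemma refinable_bigcup (I : countType) (T : Type) (A : I -> set T) :
  (forall i, refinable (A i)) -> refinable (\bigcup_i A i).
Proof.
move=> sA O.
have /choice[W /all_and2[Wo WP]] : forall i, exists W : nat -> set X,
    (forall n, nopen (W n)) /\
    forall a, A i a -> nopen (O a) -> exists n, W n `<=` closure (O a).
  by move=> i; have [W] := sA i O; exists W.
have [Z Zo ZP] := @nat_reindex (I * nat)%type (fun p => W p.1 p.2)
  (fun p => Wo p.1 p.2).
exists Z => // a [i _ Aa] Oa; have [n Wn] := WP i a Aa Oa.
by have [k Zk] := ZP (i, n); exists k; rewrite Zk.
Qed.

Lemma refinable_sub (T : Type) (A B : set T) : A `<=` B -> refinable B -> refinable A.
Proof. by move=> AB sB O; have [W Wo WP] := sB O; exists W => // a /AB; exact: WP. Qed.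

(** Lists of a fixed length form an iterated product, and there are countably many lengths. *)
Lemma refinable_seq (T : eqType) (A : set T) :
  refinable A -> refinable [set s : seq T | forall b, b \in s -> A b].
Proof.
move=> sA.
apply: (@refinable_sub _ _
    (\bigcup_k [set s : seq T | size s = k /\ forall b, b \in s -> A b])).
  by move=> s sP; exists (size s).
apply: refinable_bigcup; elim=> [|k IHk].
  apply: (@refinable_sub _ _ ((fun=> [::]) @` [set: unit])).
    by move=> s [/size0nil-> _]; exists tt.
  exact/refinable_image/refinable_countable.
apply: (refinable_sub _ (refinable_image (fun p => p.1 :: p.2) (refinable_prod sA IHk))).
move=> s [szs sP]; case: s szs sP => [//|a s] [szs] sP.
exists (a, s) => //; split=> /=.
  by apply: sP; rewrite mem_head.
by split=> // b bs; apply: sP; rewrite inE bs orbT.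
Qed.

Lemma refinable_setU1 (T : Type) (A : set T) a : refinable A -> refinable (A `|` [set a]).
Proof.
move=> sA; apply: (@refinable_sub _ _ (\bigcup_(b : bool) (if b then A else [set a]))).
  by move=> x [Ax|xa]; [exists true|exists false].
apply: refinable_bigcup => -[] //.
apply: (@refinable_sub _ _ ((fun=> a) @` [set: unit])); first by move=> _ ->; exists tt.
exact/refinable_image/refinable_countable.
Qed.

End Refinement.

(** * Greedy acceptance of indices and the points it yields *)

Section Greedy.
Context {X : topologicalType} {T : choiceType}.
Variable lt : T -> T -> Prop.
Hypothesis wf_lt : well_founded lt.
Hypothesis lt_trans : forall a b c, lt a b -> lt b c -> lt a c.
Hypothesis lt_total : forall a b, [\/ lt a b, a = b | lt b a].

Definition diffcl (O : T -> set X) (u : set X) (s : seq T) : set X :=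
  foldr (fun b U => U `\` closure (O b)) u s.

Lemma diffclE O u s x :
  diffcl O u s x <-> u x /\ forall b, b \in s -> ~ closure (O b) x.
Proof.
elim: s => [|b s IHs] /=; first by split=> [|[]].
split=> [[/IHs[ux sx] bx]|[ux sx]].
  by split=> // c; rewrite inE => /orP[/eqP->|/sx].
split; last by apply: sx; rewrite mem_head.
by apply/IHs; split=> // c cs; apply: sx; rewrite inE cs orbT.
Qed.

Lemma open_diffcl O u s : open u -> open (diffcl O u s).
Proof.
move=> uo; elim: s => //= b s IHs; apply: openI => //.
by apply: closed_openC; exact: closed_closure.
Qed.

Lemma exists_max (s : seq T) : s != [::] ->
  exists2 b, b \in s & forall c, c \in s -> lt c b \/ c = b.
Proof.
elim: s => // a [|a' s] IHs _.
  by exists a; rewrite ?mem_head// => c; rewrite inE => /eqP; right.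
have [//|b bs bP] := IHs.
have [ab|ab|ba] := lt_total a b.
- exists b; first by rewrite inE bs orbT.
  by move=> c; rewrite inE => /orP[/eqP->|/bP//]; left.
- exists b; first by rewrite inE bs orbT.
  by move=> c; rewrite inE => /orP[/eqP->|/bP//]; right.
- exists a; first by rewrite mem_head.
  move=> c; rewrite inE => /orP[/eqP->|/bP[cb|->]]; [by right| |by left].
  by left; apply: lt_trans ba.
Qed.

(** Well-founded recursion: whether [a] is accepted depends only on the accepted indices below
    [a]. *)
Lemma greedy_set (O : T -> set X) (u : set X) : exists acc : set T,
  forall a, acc a <-> forall s, (forall b, b \in s -> lt b a /\ acc b) ->
    ~ diffcl O u s `<=` closure (O a).
Proof.
pose F a (rec : forall b, lt b a -> Prop) := forall s,
  (forall b, b \in s -> exists h : lt b a, rec b h) -> ~ diffcl O u s `<=` closure (O a).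
exists (Fix wf_lt (fun=> Prop) F) => a.
rewrite Fix_eq => [|x f g fg]; last first.
  by congr F; apply: functional_extensionality_dep => b; apply: funext => h.
split=> H s sP; apply: H => b /sP.
  by move=> [ba ab]; exists ba.
by move=> [ba ab].
Qed.

(** Acceptance of the largest index [b] in [s] says that the other closures and that of [O b]
    together do not exhaust [u]. *)
Lemma diffcl_neq0 (O : T -> set X) (u : set X) (acc : set T) : u !=set0 ->
  (forall a, acc a -> forall s, (forall b, b \in s -> lt b a /\ acc b) ->
    ~ diffcl O u s `<=` closure (O a)) ->
  forall s, (forall b, b \in s -> acc b) -> diffcl O u s !=set0.
Proof.
move=> u0 accP s sacc; have [->//|s0] := eqVneq s [::].
have [b bs bP] := exists_max s0.
(* All copies of [b] are filtered out, so the remaining indices lie strictly below [b]. *)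
have /(accP b (sacc b bs)) : forall c, c \in [seq x <- s | x != b] -> lt c b /\ acc c.
  move=> c; rewrite mem_filter => /andP[/eqP cb cs].
  by split; [case: (bP c cs)|exact: sacc].
move=> /nonsubset[x [/diffclE[ux xs] xb]]; exists x; apply/diffclE; split=> // c cs.
have [->//|cb] := eqVneq c b.
by apply: xs; rewrite mem_filter cb.
Qed.

Hypothesis cptX : compact [set: X].

Lemma greedy_point (O : T -> set X) (u : set X) :
  (forall a, open (O a)) -> u !=set0 ->
  exists2 y, closure u y & forall a, O a y -> exists s,
    (forall b, b \in s -> lt b a) /\
    diffcl O u s !=set0 /\ diffcl O u s `<=` closure (O a).
Proof.
move=> Oo u0; have [acc accP] := greedy_set O u.
have ne := @diffcl_neq0 O u acc u0 (fun a => (accP a).1).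
(* The sets left by finitely many accepted indices generate a proper filter; [y] will be a cluster
   point of it. *)
pose F := filter_from [set s : seq T | forall b, b \in s -> acc b] (diffcl O u).
have FF : ProperFilter F.
  apply: filter_from_proper; last by move=> s /ne.
  apply: filter_from_filter; first by exists [::].
  move=> s t sacc tacc; exists (s ++ t).
    by move=> b; rewrite mem_cat => /orP[/sacc|/tacc].
  move=> x /diffclE[ux stx]; split; apply/diffclE; split=> // b bs; apply: stx.
    by rewrite mem_cat bs.
  by rewrite mem_cat bs orbT.
have [y [_ Fy]] := cptX FF filterT.
have uy : closure u y by move=> B yB; apply: (Fy _ _ _ yB); exists [::].
have yacc a : acc a -> ~ O a y.
  move=> aa Oay; have [||x [/diffclE[_ xa] Oax]] := Fy (diffcl O u [:: a]) (O a).
  - by exists [:: a] => // b; rewrite inE => /eqP->.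
  - exact: open_nbhs_nbhs.
  by apply: (xa a (mem_head _ _)); exact: subset_closure.
(* An index [a] with [O a y] is thus rejected, and the list [s] witnesses the rejection. *)
exists y => // a Oay; apply: contrapT => nos; apply: (yacc a) => //.
apply/accP => s sP sO; apply: nos; exists s; split; first by move=> b /sP[].
by split=> //; apply: ne => b /sP[].
Qed.

Variable x0 : X.
Hypothesis SX : S_separable X.
Hypothesis regX : forall U : set X, nopen U -> exists2 V, nopen V & closure V `<=` U.

(** The chosen points form a dense set, and S-separability for the constant sequence gives a
    countable dense subset of it. *)
Lemma dense_selection (y : set X -> X) : (forall U, nopen U -> closure U (y U)) ->
  exists2 u : nat -> set X, (forall n, nopen (u n)) &
    forall U, nopen U -> exists n, U (y (u n)).
Proof.
move=> yP; have dY : dense (y @` nopen).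
  move=> U U0 Uo; have [//|V Vo VU] := regX (U := U).
  by exists (y V); split; [exact/VU/yP|exists V].
have [F [FP Fhit]] := SX (fun=> dY).
have cF : countable (\bigcup_n F n).
  apply: bigcup_countable => // n _; apply: finite_set_countable.
  by have [] := FP n.
have FY z : (\bigcup_n F n) z -> exists2 u, nopen u & y u = z.
  by move=> [n _ /((FP n).2)].
(* Density only needs the finite collection consisting of [U] alone. *)
have hit U : nopen U -> exists2 z, (\bigcup_n F n) z & U z.
  move=> Uo; have [||n nP] := Fhit [set U]; first exact: finite_set1.
    by move=> _ ->.
  by have [z [Uz Fz]] := nP U erefl; exists z => //; exists n.
have /pfcard_geP[F0|[g]] := cF.
  by have [z] := hit _ (nopenT x0); rewrite F0.
have /choice[u uP] : forall n, exists u, nopen u /\ y u = g n.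
  by move=> n; have [|u uo yu] := FY (g n); [exact: funS|exists u].
exists u => [n|U /hit[z Fz Uz]]; first by have [] := uP n.
by have [n _ gn] := surj (f := g) Fz; exists n; have [_ ->] := uP n; rewrite gn.
Qed.

Lemma countable_greedy (O : T -> set X) : (forall a, open (O a)) ->
  exists2 u : nat -> set X, (forall n, nopen (u n)) &
    forall a, nopen (O a) -> exists n s, (forall b, b \in s -> lt b a) /\
      nopen (diffcl O (u n) s) /\ diffcl O (u n) s `<=` closure (O a).
Proof.
move=> Oo.
have /choice[y yP] : forall U : set X, exists y, nopen U -> closure U y /\
    forall a, O a y -> exists s, (forall b, b \in s -> lt b a) /\
      diffcl O U s !=set0 /\ diffcl O U s `<=` closure (O a).
  move=> U; have [Uo|nU] := pselect (nopen U); last by exists x0.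
  by have [y Uy yP] := greedy_point Oo Uo.2; exists y.
have [u uo uP] := @dense_selection y (fun U Uo => (yP U Uo).1).
exists u => // a /uP[n Oy]; exists n.
have [s [sa [s0 sO]]] := (yP _ (uo n)).2 a Oy.
exists s; split=> //; split=> //; split=> //.
by apply: open_diffcl; have [] := uo n.
Qed.

(** * Descent along the well-order *)

Variable A : set T.
Hypothesis downA : forall a b, A a -> lt b a -> A b.
Hypothesis refA : forall a, A a -> @refinable X _ [set b | lt b a].

(** One round treats countably many families [O m] together. The new families come from refining,
    for each [b], all remainders whose removed indices are at most [b]. *)
Lemma descent_step (O : nat -> T -> set X) : (forall m a, nopen (O m a)) ->
  exists p : (nat -> nat -> set X) * (nat -> T -> set X),
    (forall m n, nopen (p.1 m n)) /\ (forall m a, nopen (p.2 m a)) /\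
    forall m a, A a -> (exists n, p.1 m n `<=` closure (O m a)) \/
      exists b m', lt b a /\ p.2 m' b `<=` closure (O m a).
Proof.
move=> Oo.
have /choice[u /all_and2[uo uP]] : forall m, exists u : nat -> set X,
    (forall n, nopen (u n)) /\
    forall a, nopen (O m a) -> exists n s, (forall b, b \in s -> lt b a) /\
      nopen (diffcl (O m) (u n) s) /\ diffcl (O m) (u n) s `<=` closure (O m a).
  move=> m; have [|u uo uP] := @countable_greedy (O m); last by exists u.
  by move=> a; case: (Oo m a).
have /choice[W WP] : forall a, exists W : nat -> set X,
    (forall n, nopen (W n)) /\ (A a -> forall m n s,
    (forall b, b \in s -> lt b a \/ b = a) -> nopen (diffcl (O m) (u m n) s) ->
    exists k, W k `<=` closure (diffcl (O m) (u m n) s)).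
  move=> a; have [Aa|nAa] := pselect (A a); last first.
    by exists (fun=> setT); split=> // _; exact: nopenT.
  (* Pairs [(m, n)] combined with lists of indices at most [a] form a refinable set, so one sequence
     serves all [m], [n] and [s]. *)
  have /(refinable_prod x0) := refinable_countable x0 [set: nat * nat].
  move=> /(_ _ _ (refinable_seq x0 (refinable_setU1 x0 a (refA Aa)))).
  move=> /(_ (fun p => diffcl (O p.1.1) (u p.1.1 p.1.2) p.2))[W Wo WP].
  exists W; split=> // _ m n s sa so; have [|k] := WP ((m, n), s) _ so.
    by split=> // b /sa.
  by exists k.
exists (u, fun m a => W a m); split=> //; split=> [m a|m a Aa] /=.
  by case: (WP a).
have [n [s [sa [so sO]]]] := uP m a (Oo m a).
(* If nothing is removed, [u m n] itself refines [O m a]; otherwise pass to the largest removed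
   index. *)
have [s0|/exists_max[b bs bP]] := eqVneq s [::].
  by left; exists n; rewrite s0 in sO.
right; exists b.
have [k kP] := (WP b).2 (downA Aa (sa b bs)) m n s bP so.
by exists k; split; [exact: sa|exact: refine_trans sO].
Qed.

Lemma refinable_of_initial : @refinable X _ A.
Proof.
move=> O0.
pose st := {O : nat -> T -> set X | forall m a, nopen (O m a)}.
have /choice[f fP] : forall O : st, exists p : (nat -> nat -> set X) * st,
    (forall m n, nopen (p.1 m n)) /\
    forall m a, A a -> (exists n, p.1 m n `<=` closure (sval O m a)) \/
      exists b m', lt b a /\ sval p.2 m' b `<=` closure (sval O m a).
  move=> [O Oo]; have [[u O'] /= [uo [O'o OP]]] := descent_step Oo.
  by exists (u, exist _ O' O'o).
(* All families of the first round coincide. *)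
pose S0 : st := exist (fun O => forall m a, nopen (O m a)) (fun=> fill \o O0) (fun m a => nopen_fill x0 (O0 a)).
pose S k := iter k (fun O => (f O).2) S0.
(* Enumerates the sets [u] by round, family and position. *)
have [W Wo WP] := @nat_reindex _ x0 (nat * nat * nat)%type
  (fun p => (f (S p.1.1)).1 p.1.2 p.2) (fun p => (fP (S p.1.1)).1 p.1.2 p.2).
exists W => // a Aa Oa.
(* Generalized over [k] and [m], since each descent moves to the next round and possibly another
   family. *)
suff H : forall k m, exists n, W n `<=` closure (sval (S k) m a).
  by have [n] := H 0%N 0%N; rewrite /= fill_id//; exists n.
elim/(well_founded_ind wf_lt): a Aa {Oa} => a IHa Aa k m.
have [[n nP]|[b [m' [ba bP]]]] := (fP (S k)).2 m a Aa.
  by have [i Wi] := WP (k, m, n); exists i; rewrite Wi.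
have [i iP] := IHa b ba (downA Aa ba) k.+1 m'.
by exists i; exact: refine_trans bP.
Qed.

End Greedy.

(** * The two implications *)

Lemma S_separable_pi_weight (X : topologicalType) : compact [set: X] ->
  hausdorff_space X -> S_separable X -> pi_weight_omega X.
Proof.
move=> cptX hX SX.
have regX (U : set X) : nopen U -> exists2 V, nopen V & closure V `<=` U.
  move=> [Uo [x Ux]].
  have [V Vx VU] := compact_regular hX cptX filterT (open_nbhs_nbhs (conj Uo Ux)).
  exists V°; last by apply: subset_trans VU; apply: closureS; exact: interior_subset.
  by split; [exact: open_interior|exists x].
have [[x0 _]|noX] := pselect (exists x : X, True); last first.
  by exists set0; split=> //; split=> // U _ [x _]; case: noX; exists x.
(* The subsets of [X] index themselves, so the family to refine is the identity. *)
have [lt [wf tr tot]] := well_order_lt (set X).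
have init (U : set X) : @refinable X _ [set V | lt V U].
  elim/(well_founded_ind wf): U => U IHU.
  apply: (refinable_of_initial wf tr tot cptX x0 SX regX) => [V W /= VU WV|//].
  exact: tr VU.
have sT : @refinable X (set X) setT.
  by apply: (refinable_of_initial wf tr tot cptX x0 SX regX) => // V _; exact: init.
have [W Wo WP] := sT id.
exists (range W); split; first exact: sub_countable (card_image_le _ _) (countableP _).
split=> [_ [n _ <-]|U Uo U0]; first by case: (Wo n).
(* Shrinking [U] to [V] with closure inside [U] turns refinement up to closure into inclusion. *)
have [//|V Vo VU] := regX U; have [n nP] := WP V I Vo.
by exists (W n); split; [exists n|case: (Wo n)|exact: subset_trans VU].
Qed.

(** From [Y n] take one point in each of the first [n.+1] members of the pi-base; a finite
    collection involves only boundedly many of these members. *)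
Lemma pi_weight_S_separable (X : topologicalType) :
  pi_weight_omega X -> S_separable X.
Proof.
move=> [B [cB [Bo BP]]] Y dY.
have [[x0 _]|noX] := pselect (exists x : X, True); last first.
  exists (fun=> set0); split=> [n|G _ GP]; first by split.
  by exists 0%N => U /GP[_ [x _]]; case: noX; exists x.
have [B0|[b]] := pfcard_geP cB.
  by have [V []] := BP _ openT (ex_intro _ x0 I); rewrite B0.
have /choice[y yP] : forall p : nat * nat, exists y,
    Y p.1 y /\ (b p.2 !=set0 -> b p.2 y).
  move=> [n k] /=; have [b0|b0] := pselect (b k !=set0).
    by have [|y [by_ Yy]] := dY n _ b0; [exact/Bo/funS|exists y].
  (* For an empty [b k], any point of [Y n] will do. *)
  by have [|y [_ Yy]] := dY n _ _ openT; [exists x0|exists y].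
exists (fun n => (fun k => y (n, k)) @` `I_n.+1); split=> [n|G finG GP].
  split; first exact/finite_image/finite_II.
  by move=> _ [k _ <-]; case: (yP (n, k)).
have /choice[k kP] : forall U, exists k, G U -> b k !=set0 /\ b k `<=` U.
  move=> U; have [/GP[Uo U0]|nG] := pselect (G U); last by exists 0%N.
  have [V [BV V0 VU]] := BP U Uo U0; have [k _ bk] := surj (f := b) BV.
  by exists k; rewrite bk.
have [n nP] : exists n, forall U, G U -> (k U <= n)%N.
  have /finite_seqP[s sP] := finite_image k finG.
  exists (\max_(i <- s) i) => U GU; apply: leq_bigmax_seq => //.
  by suff : [set` s] (k U) by []; rewrite -sP; exists U.
exists n => U GU; have [b0 bU] := kP U GU.
exists (y (n, k U)); split; first by apply: bU; case: (yP (n, k U)) => _; exact.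
by exists (k U) => //=; rewrite ltnS nP.
Qed.

Theorem proposition3p13 (X : topologicalType) :
  compact [set: X] -> hausdorff_space X ->
  (S_separable X <-> pi_weight_omega X).
Proof.
move=> cptX hX; split; first exact: S_separable_pi_weight.
exact: pi_weight_S_separable.
Qed.
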